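(* Let $\mathbb{C}$ be a category and $\mathcal{N}$ an ideal in $\mathbb{C}$ such that $\mathbb{C}$ has kernel pairs, $\mathcal{N}$-kernels, and coequalizers of kernel pairs. Then every regular epimorphism in $\mathbb{C}$ is a coequalizer of its kernel star if and only if every reflexive graph in $\mathbb{C}$ satisfies $(\ast\pi_0)$. In particular, if $\mathbb{C}$ is a regular category and $\mathcal{N}$ is an ideal in $\mathbb{C}$ such that $\mathcal{N}$-kernels exist, then $(\mathbb{C},\mathcal{N})$ is a star-regular category if and only if every reflexive graph in $\mathbb{C}$ satisfies $(\ast\pi_0)$.
   Context: An ideal in a category $\mathbb{C}$ is a class $\mathcal{N}$ of morphisms such that whenever $fgh$ is a composite of three morphisms with $g\in\mathcal{N}$, then $fgh\in\mathcal{N}$. A pair $(\mathbb{C},\mathcal{N})$ with $\mathcal{N}$ an ideal of $\mathbb{C}$ is called a multi-pointed category. An $\mathcal{N}$-kernel of $f:X\to Y$ is a morphism $k:K\to X$ with $fk\in\mathcal{N}$ such that for every $k':K'\to X$ with $fk'\in\mathcal{N}$ there is a unique $u:K'\to K$ with $k'=ku$; a weak $\mathcal{N}$-kernel is defined in the same way but without requiring uniqueness of $u$. The $\mathcal{N}$-star (respectively, a weak $\mathcal{N}$-star) of an ordered pair $(f_1,f_2)$ of parallel morphisms is the pair $(f_1k,f_2k)$ where $k$ is an $\mathcal{N}$-kernel (respectively, a weak $\mathcal{N}$-kernel) of $f_1$. The kernel star of a morphism is the $\mathcal{N}$-star of its kernel pair. Condition $(\ast\pi_0)$ on an ordered pair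 $(f_1,f_2)$ of parallel morphisms $f_1,f_2:X\to Y$: for a weak $\mathcal{N}$-star $(f_1k,f_2k)$ of $(f_1,f_2)$ and for any morphism $g:Y\to Z$, one has $gf_1k=gf_2k \Leftrightarrow gf_1=gf_2$. (When a weak $\mathcal{N}$-star exists, requiring this for one weak $\mathcal{N}$-star, or for an $\mathcal{N}$-star if one exists, is equivalent to requiring it for all weak $\mathcal{N}$-stars.) A reflexive graph consists of morphisms $d,c:G_1\to G_0$ and $e:G_0\to G_1$ with $de=ce=1_{G_0}$; it satisfies $(\ast\pi_0)$ if the ordered pair $(d,c)$ does. A star-regular category is a pair $(\mathbb{C},\mathcal{N})$ where $\mathbb{C}$ is a regular category, $\mathcal{N}$ is an ideal in $\mathbb{C}$ admitting kernels (every morphism has an $\mathcal{N}$-kernel), and every regular epimorphism in $\mathbb{C}$ is a coequalizer of its kernel star. *)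

(* Defs.v *)
Set Implicit Arguments.
Unset Strict Implicit.
Unset Printing Implicit Defensive.

Declare Scope cat_scope.
Delimit Scope cat_scope with cat.

Record category : Type := Category {
  ob :> Type;
  hom : ob -> ob -> Type;
  idm : forall X : ob, hom X X;
  comp : forall X Y Z : ob, hom Y Z -> hom X Y -> hom X Z;
  comp_idl : forall (X Y : ob) (f : hom X Y), comp (idm Y) f = f;
  comp_idr : forall (X Y : ob) (f : hom X Y), comp f (idm X) = f;
  comp_assoc : forall (W X Y Z : ob) (f : hom Y Z) (g : hom X Y) (h : hom W X),
    comp f (comp g h) = comp (comp f g) h
}.

Arguments hom {_} _ _.
Arguments idm {_} _.
Arguments comp {_ _ _ _} _ _.

(* [g ∘ f] is "f first, then g". *)
Notation "g ∘ f" := (comp g f) (at level 40, left associativity) : cat_scope.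
Local Open Scope cat_scope.

Section Limits.
Variable C : category.

Definition is_terminal (T : C) : Prop :=
  forall X : C, exists! t : hom X T, True.

Definition is_pullback (X Y Z P : C) (f : hom X Z) (g : hom Y Z)
    (p : hom P X) (q : hom P Y) : Prop :=
  f ∘ p = g ∘ q /\
  forall (W : C) (a : hom W X) (b : hom W Y), f ∘ a = g ∘ b ->
    exists! u : hom W P, p ∘ u = a /\ q ∘ u = b.

Definition is_kernel_pair (X Y R : C) (f : hom X Y) (r1 r2 : hom R X) : Prop :=
  is_pullback f f r1 r2.

Definition is_coequalizer (X Y Q : C) (a b : hom X Y) (q : hom Y Q) : Prop :=
  q ∘ a = q ∘ b /\
  forall (Z : C) (g : hom Y Z), g ∘ a = g ∘ b -> exists! u : hom Q Z, u ∘ q = g.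

Definition is_regular_epi (X Y : C) (f : hom X Y) : Prop :=
  exists (W : C) (a b : hom W X), is_coequalizer a b f.

End Limits.

Definition has_terminal (C : category) : Prop :=
  exists T : C, is_terminal T.

Definition has_pullbacks (C : category) : Prop :=
  forall (X Y Z : C) (f : hom X Z) (g : hom Y Z),
    exists (P : C) (p : hom P X) (q : hom P Y), is_pullback f g p q.

Definition has_kernel_pairs (C : category) : Prop :=
  forall (X Y : C) (f : hom X Y),
    exists (R : C) (r1 r2 : hom R X), is_kernel_pair f r1 r2.

Definition has_coequalizers_of_kernel_pairs (C : category) : Prop :=
  forall (X Y R : C) (f : hom X Y) (r1 r2 : hom R X), is_kernel_pair f r1 r2 ->
    exists (Q : C) (q : hom X Q), is_coequalizer r1 r2 q.

(* Finite completeness is expressed as a terminal object plus all pullbacks. *)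
Definition regular_category (C : category) : Prop :=
  has_terminal C /\
  has_pullbacks C /\
  has_coequalizers_of_kernel_pairs C /\
  (forall (X Y Z P : C) (f : hom X Z) (g : hom Y Z) (p : hom P X) (q : hom P Y),
     is_pullback f g p q -> is_regular_epi f -> is_regular_epi q).

Record ideal (C : category) : Type := Ideal {
  in_ideal : forall X Y : C, hom X Y -> Prop;
  ideal_comp : forall (W X Y Z : C) (f : hom Y Z) (g : hom X Y) (h : hom W X),
    in_ideal g -> in_ideal (f ∘ g ∘ h)
}.

Arguments in_ideal {_} _ {_ _} _.

Section Stars.
Variables (C : category) (N : ideal C).

Definition is_kernel (X Y K : C) (f : hom X Y) (k : hom K X) : Prop :=
  in_ideal N (f ∘ k) /\
  forall (K' : C) (k' : hom K' X), in_ideal N (f ∘ k') ->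
    exists! u : hom K' K, k' = k ∘ u.

Definition is_weak_kernel (X Y K : C) (f : hom X Y) (k : hom K X) : Prop :=
  in_ideal N (f ∘ k) /\
  forall (K' : C) (k' : hom K' X), in_ideal N (f ∘ k') ->
    exists u : hom K' K, k' = k ∘ u.

Definition has_kernels : Prop :=
  forall (X Y : C) (f : hom X Y), exists (K : C) (k : hom K X), is_kernel f k.

(* [(s1, s2)] is a (weak) star of the ordered pair [(f1, f2)]; the kernel is
   that of the first component [f1]. *)
Definition is_star (X Y K : C) (f1 f2 : hom X Y) (s1 s2 : hom K Y) : Prop :=
  exists k : hom K X, is_kernel f1 k /\ s1 = f1 ∘ k /\ s2 = f2 ∘ k.

Definition is_weak_star (X Y K : C) (f1 f2 : hom X Y) (s1 s2 : hom K Y) : Prop :=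
  exists k : hom K X, is_weak_kernel f1 k /\ s1 = f1 ∘ k /\ s2 = f2 ∘ k.

Definition is_kernel_star (X Y K : C) (f : hom X Y) (s1 s2 : hom K X) : Prop :=
  exists (R : C) (r1 r2 : hom R X), is_kernel_pair f r1 r2 /\ is_star r1 r2 s1 s2.

(* Kernel stars are unique up to isomorphism; when none exists this is vacuous,
   so it is only meaningful together with the existence of kernel pairs and of
   kernels. *)
Definition is_coequalizer_of_kernel_star (X Y : C) (f : hom X Y) : Prop :=
  forall (K : C) (s1 s2 : hom K X), is_kernel_star f s1 s2 -> is_coequalizer s1 s2 f.

Definition regular_epis_coequalize_kernel_stars : Prop :=
  forall (X Y : C) (f : hom X Y),
    is_regular_epi f -> is_coequalizer_of_kernel_star f.

Definition star_pi0 (X Y : C) (f1 f2 : hom X Y) : Prop :=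
  forall (K : C) (s1 s2 : hom K Y), is_weak_star f1 f2 s1 s2 ->
  forall (Z : C) (g : hom Y Z), g ∘ s1 = g ∘ s2 <-> g ∘ f1 = g ∘ f2.

Definition star_regular_category : Prop :=
  regular_category C /\ has_kernels /\ regular_epis_coequalize_kernel_stars.

End Stars.

Record reflexive_graph (C : category) : Type := ReflexiveGraph {
  rg_ob1 : C;
  rg_ob0 : C;
  rg_d : hom rg_ob1 rg_ob0;
  rg_c : hom rg_ob1 rg_ob0;
  rg_e : hom rg_ob0 rg_ob1;
  rg_de : rg_d ∘ rg_e = idm rg_ob0;
  rg_ce : rg_c ∘ rg_e = idm rg_ob0
}.

Definition reflexive_graphs_star_pi0 (C : category) (N : ideal C) : Prop :=
  forall G : reflexive_graph C, star_pi0 N (rg_d G) (rg_c G).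

(* Main.v *)
Require Import Defs.

(** If reflexive graphs satisfy the star condition, apply it to the kernel pair
    [(r1, r2)] of a regular epimorphism [f], which is a reflexive graph via the
    diagonal: a morphism coequalizes the kernel star exactly when it coequalizes
    [(r1, r2)], and [f] is a coequalizer of [(r1, r2)]
    ([regular_epi_coequalizer_kernel_pair]).

    Conversely, let [(d, c, e)] be a reflexive graph, [k] a weak kernel of [d],
    and suppose [g ∘ d ∘ k = g ∘ c ∘ k].  It is enough that [g ∘ c] factors
    through [d], for composing with [e] then identifies the factor as [g].  Now
    [d] is a split, hence regular, epimorphism, so by hypothesis it is a
    coequalizer of its kernel star [(s1, s2)], and the factorization reduces to
    [g ∘ c ∘ s1 = g ∘ c ∘ s2].  Both [d ∘ s1] and [d ∘ s2] are in the ideal, so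
    [s1] and [s2] factor through [k]; on such morphisms [g ∘ c] agrees with
    [g ∘ d], and [d ∘ s1 = d ∘ s2]. *)

Local Open Scope cat_scope.

Lemma in_ideal_compl (C : category) (N : ideal C) (X Y Z : C)
    (f : hom Y Z) (g : hom X Y) : in_ideal N g -> in_ideal N (f ∘ g).
Proof.
  intro Hg. rewrite <- (comp_idr (f ∘ g)). now apply ideal_comp.
Qed.

(** The presenting pair is the idempotent [e ∘ d] and the identity. *)
Lemma split_epi_regular_epi (C : category) (X Y : C)
    (d : hom X Y) (e : hom Y X) : d ∘ e = idm Y -> is_regular_epi d.
Proof.
  intro de. exists X, (e ∘ d), (idm X). split.
  - now rewrite comp_assoc, de, comp_idl, comp_idr.
  - intros Z g Hg. rewrite comp_assoc, comp_idr in Hg.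
    exists (g ∘ e). split; [exact Hg |].
    intros u Hu.
    now rewrite <- Hu, <- comp_assoc, de, comp_idr.
Qed.

(** Any pair [(a, b)] presenting [f] as a coequalizer factors through the
    kernel pair, so a morphism coequalizing the kernel pair also coequalizes
    [(a, b)]. *)
Lemma regular_epi_coequalizer_kernel_pair (C : category) (X Y R : C)
    (f : hom X Y) (r1 r2 : hom R X) :
  is_regular_epi f -> is_kernel_pair f r1 r2 -> is_coequalizer r1 r2 f.
Proof.
  intros [W [a [b [Hab Huniv]]]] [Hr Hpb]. split; [exact Hr |].
  intros Z g Hg. apply Huniv.
  destruct (Hpb W a b Hab) as [w [[Ha Hb] _]].
  now rewrite <- Ha, <- Hb, !comp_assoc, Hg.
Qed.

Lemma kernel_pair_diagonal (C : category) (X Y R : C)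
    (f : hom X Y) (r1 r2 : hom R X) :
  is_kernel_pair f r1 r2 ->
  exists e : hom X R, r1 ∘ e = idm X /\ r2 ∘ e = idm X.
Proof.
  intros [_ Hpb].
  destruct (Hpb X (idm X) (idm X) eq_refl) as [e [He _]].
  now exists e.
Qed.

Lemma kernel_weak_kernel (C : category) (N : ideal C) (X Y K : C)
    (f : hom X Y) (k : hom K X) : is_kernel N f k -> is_weak_kernel N f k.
Proof.
  intros [Hk Huniv]. split; [exact Hk |].
  intros K' k' Hk'. destruct (Huniv K' k' Hk') as [u [Hu _]]. now exists u.
Qed.

Lemma star_weak_star (C : category) (N : ideal C) (X Y K : C)
    (f1 f2 : hom X Y) (s1 s2 : hom K Y) :
  is_star N f1 f2 s1 s2 -> is_weak_star N f1 f2 s1 s2.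
Proof.
  intros [k [Hk Hs]]. exists k. split; [now apply kernel_weak_kernel | exact Hs].
Qed.

Lemma kernel_star_exists (C : category) (N : ideal C) :
  has_kernel_pairs C -> has_kernels N ->
  forall (X Y : C) (f : hom X Y),
    exists (K : C) (s1 s2 : hom K X), is_kernel_star N f s1 s2.
Proof.
  intros HKP HK X Y f.
  destruct (HKP X Y f) as [R [r1 [r2 Hr]]].
  destruct (HK R X r1) as [K [k Hk]].
  exists K, (r1 ∘ k), (r2 ∘ k), R, r1, r2. split; [exact Hr |].
  now exists k.
Qed.

Lemma kernel_star_coequalized (C : category) (N : ideal C) (X Y K : C)
    (f : hom X Y) (s1 s2 : hom K X) :
  is_kernel_star N f s1 s2 -> f ∘ s1 = f ∘ s2.
Proof.
  intros [R [r1 [r2 [[Hr _] [k [_ [E1 E2]]]]]]].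
  now rewrite E1, E2, !comp_assoc, Hr.
Qed.

Lemma kernel_star_in_ideal (C : category) (N : ideal C) (X Y K : C)
    (f : hom X Y) (s1 s2 : hom K X) :
  is_kernel_star N f s1 s2 -> in_ideal N s1.
Proof.
  intros [R [r1 [r2 [_ [k [[Hk _] [E1 _]]]]]]]. now rewrite E1.
Qed.

Lemma star_pi0_kernel_star_coequalizer (C : category) (N : ideal C) :
  reflexive_graphs_star_pi0 N -> regular_epis_coequalize_kernel_stars N.
Proof.
  intros Hpi0 X Y f Hf K s1 s2 Hs. split.
  - now apply (kernel_star_coequalized _ N).
  - intros Z g Hg.
    destruct Hs as [R [r1 [r2 [Hr Hs]]]].
    destruct (kernel_pair_diagonal _ _ _ _ _ _ _ Hr) as [e [He1 He2]].
    destruct (regular_epi_coequalizer_kernel_pair _ _ _ _ _ _ _ Hf Hr)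
      as [_ Huniv].
    apply Huniv.
    apply (Hpi0 (ReflexiveGraph He1 He2) K s1 s2); [| exact Hg].
    now apply star_weak_star.
Qed.

(** The section [e] serves twice: it makes [d] a regular epimorphism, and it
    turns a factorization [u ∘ d = g ∘ c] into [u = g ∘ c ∘ e = g]. *)
Lemma kernel_star_coequalizer_star_pi0 (C : category) (N : ideal C) :
  has_kernel_pairs C -> has_kernels N ->
  regular_epis_coequalize_kernel_stars N -> reflexive_graphs_star_pi0 N.
Proof.
  intros HKP HK Hreg [G1 G0 d c e de ce] L t1 t2 [k [[_ Hk] [E1 E2]]] Z g.
  simpl in *. subst t1 t2. rewrite !comp_assoc.
  split; [| intro Hg; now rewrite Hg].
  intro Hg.
  destruct (kernel_star_exists _ N HKP HK _ _ d) as [K [s1 [s2 Hs]]].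
  pose proof (kernel_star_coequalized _ _ _ _ _ _ _ _ Hs) as Hds.
  assert (Hn : in_ideal N (d ∘ s1)).
  { apply in_ideal_compl. exact (kernel_star_in_ideal _ _ _ _ _ _ _ _ Hs). }
  destruct (Hk K s1 Hn) as [u1 Hu1].
  rewrite Hds in Hn.
  destruct (Hk K s2 Hn) as [u2 Hu2].
  assert (Hcd : forall u : hom K L, g ∘ c ∘ (k ∘ u) = g ∘ d ∘ (k ∘ u)).
  { intro u. now rewrite !comp_assoc, Hg. }
  destruct (Hreg _ _ d (split_epi_regular_epi _ _ _ _ _ de) K s1 s2 Hs)
    as [_ Huniv].
  destruct (Huniv Z (g ∘ c)) as [u [Hu _]].
  { rewrite Hu1, Hu2, !Hcd, <- Hu1, <- Hu2, <- !comp_assoc. now rewrite Hds. }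
  assert (Eu : u = g).
  { rewrite <- (comp_idr u), <- de, comp_assoc, Hu, <- comp_assoc, ce.
    apply comp_idr. }
  now rewrite <- Hu, Eu.
Qed.

Theorem corollary2p3 :
  (forall (C : category) (N : ideal C),
     has_kernel_pairs C -> has_kernels N -> has_coequalizers_of_kernel_pairs C ->
     (regular_epis_coequalize_kernel_stars N <-> reflexive_graphs_star_pi0 N)) /\
  (forall (C : category) (N : ideal C),
     regular_category C -> has_kernels N ->
     (star_regular_category N <-> reflexive_graphs_star_pi0 N)).
Proof.
  split.
  - intros C N HKP HK _. split.
    + now apply kernel_star_coequalizer_star_pi0.
    + apply star_pi0_kernel_star_coequalizer.
  - intros C N HC HK. split.
    + intros [[_ [HP _]] [_ Hreg]].
      apply kernel_star_coequalizer_star_pi0; [| exact HK | exact Hreg].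
      intros X Y f. exact (HP X X Y f f).
    + intro Hpi0. split; [exact HC | split; [exact HK |]].
      now apply star_pi0_kernel_star_coequalizer.
Qed.
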